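(* On the class of Friggstad–Gao instances, for any $0<c\le1$ the integrality gap of both $P^{k^c}$ and $P^{k^c}_{\operatorname{rank}}$ is $O(1/c)$. That is, there is an absolute constant $C>0$ such that for every $h\ge2$ and every $0<c\le 1$, with $k$ the number of requests of $T_{FG}^h$, both integrality gaps on the instance $T_{FG}^h$ are at most $C/c$.
   Context: ANF-Tree: an instance consists of an undirected tree $(V,E)$ with edge capacities $u_e>0$ and a finite set $R$ of requests; each request $q\in R$ has endpoints $s_q\neq t_q$, demand $d_q\ge 0$, profit $w_q\ge0$. Let $P_q$ be the simple path between $s_q$ and $t_q$, $R_e=\{q\in R:e\in P_q\}$, $k=|R|$, $m=|E|$. A set $X\subseteq R$ is feasible (routable) if $\sum_{q\in X\cap R_e}d_q\le u_e$ for all $e\in E$. Let $P=\{x\in[0,1]^R:\sum_{q\in R_e}d_qx_q\le u_e\ \forall e\in E\}$ and $P_I=\operatorname{conv}(P\cap\{0,1\}^R)$. For $S\subseteq E$ let $K(S)=\{x\in[0,1]^R:\sum_{q\in R_e}d_qx_q\le u_e\ \forall e\in S\}$, $K_I(S)=\operatorname{conv}(K(S)\cap\{0,1\}^R)$, and for $1\le t\le m$ let $P^t=\bigcap_{S\subseteq E,|S|=t}K_I(S)$. For $X\subseteq R$ let $\operatorname{rank}(X)=\max\{|Y|:Y\subseteq X,\ Y\text{ feasible}\}$; the rank constraint of $X$ is $\sum_{q\in X}x_q\le\operatorname{rank}(X)$. $P^t_{\operatorname{rank}}$ denotes the polytope of all $x\in P^t$ satisfying every rank constraint ($X\subseteq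 R$). $P^{k^c}$ means $P^t$ with $t=\lfloor k^c\rfloor$, and likewise for $P^{k^c}_{\operatorname{rank}}$. The integrality gap of a relaxation $Q\supseteq P_I$ is $\max\{w^Tx:x\in Q\}/\max\{w^Tx:x\in P_I\}$. Friggstad–Gao instance $T_{FG}^h$ ($h\ge2$): a rooted tree with root $r$ having a single child $v_1$; every vertex other than $r$ and the leaves has exactly $2^{h-1}$ children, and the leaves are at distance $h$ from $r$. Let $level_\ell$ be the set of vertices at distance $\ell$ from $r$, so $|level_\ell|=2^{(h-1)(\ell-1)}$ for $1\le\ell\le h$. An edge between $level_{\ell-1}$ and $level_\ell$ has capacity $2^{h(h-\ell+1)}$. For each $\ell\ge1$ and each $v\in level_\ell$ there is one request, with endpoints $v$ and $r$, demand $2^{h(h-\ell+1)}-2^{h(h-\ell)}$ and profit $2^{-(h-1)(\ell-1)}$. Thus $k=m=\sum_{i=0}^{h-1}2^{(h-1)i}$. *)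

(* Defs.v *)
From mathcomp Require Import all_boot all_order all_algebra.
From mathcomp Require Import all_classical all_reals all_analysis.

Set Implicit Arguments.
Unset Strict Implicit.
Unset Printing Implicit Defensive.

Import Order.TTheory GRing.Theory Num.Theory.
Local Open Scope classical_set_scope.
Local Open Scope ring_scope.

(* An edge is the two-element set of its endpoints; [cap] is only meaningful
   on the sets that are edges. *)
Record anf_tree (R : realType) := AnfTree {
  vert : finType;
  adj : rel vert;
  adj_sym : symmetric adj;
  adj_irr : irreflexive adj;
  adj_connected : forall x y, connect adj x y;
  (* MathComp cycles of size at most 2 are closed walks x, x or x, y, x. *)
  adj_acyclic : forall c : seq vert, ucycle adj c -> (size c <= 2)%N;
  cap : {set vert} -> R;
  cap_gt0 : forall x y, adj x y -> 0 < cap [set x; y]%SET;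
  req : finType;
  src : req -> vert;
  tgt : req -> vert;
  src_neq_tgt : forall q, src q != tgt q;
  dem : req -> R;
  dem_ge0 : forall q, 0 <= dem q;
  profit : req -> R;
  profit_ge0 : forall q, 0 <= profit q
}.

Section AnfTree.
Variables (R : realType) (I : anf_tree R).

Notation V := (vert I).
Notation Q := (req I).

Definition edges : {set {set V}} :=
  [set e : {set V} | [exists x, exists y, adj x y && (e == [set x; y]%SET)]]%SET.

(* The walk x :: p is a simple path from x to y. *)
Definition simple_path (x y : V) : pred (seq V) :=
  [pred p | [&& path (@adj _ I) x p, uniq (x :: p) & last x p == y]].

Lemma simple_path_exists (x y : V) : exists p, simple_path x y p.
Proof.
have /connectP[p p_path ->] := adj_connected x y.
case/shortenP: p_path => p' p'_path p'_uniq _.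
by exists p'; apply/and3P; split.
Qed.

(* The simple path is unique because the graph is acyclic. *)
Definition the_path (x y : V) : seq V := xchoose (simple_path_exists x y).

Definition path_edges (q : Q) : {set {set V}} :=
  let p := the_path (src q) (tgt q) in
  [set e in [seq [set a.1; a.2]%SET | a <- zip (src q :: p) p]]%SET.

Definition req_through (e : {set V}) : {set Q} :=
  [set q | e \in path_edges q]%SET.

Definition feasible (X : {set Q}) : bool :=
  [forall e in edges, \sum_(q in X :&: req_through e) dem q <= cap e].

Definition vec := {ffun Q -> R^o}.

Definition K_rel (S : {set {set V}}) : set vec :=
  [set x : vec | (forall q, 0 <= x q <= 1) /\
    (forall e, e \in S -> \sum_(q in req_through e) dem q * x q <= cap e)].

Definition zero_one : set vec := [set x : vec | forall q, x q = 0 \/ x q = 1].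

Definition conv_hull (A : set vec) : set vec := smallest (@convex_set R vec) A.

Definition K_int (S : {set {set V}}) : set vec := conv_hull (K_rel S `&` zero_one).

Definition P_rel : set vec := K_rel edges.

Definition P_int : set vec := conv_hull (P_rel `&` zero_one).

(* Only used for 1 <= t <= #|edges|. *)
Definition P_level (t : nat) : set vec :=
  \bigcap_(S in [set S : {set {set V}} | S \subset edges /\ #|S| = t]) K_int S.

Definition rank (X : {set Q}) : nat :=
  \max_(Y : {set Q} | (Y \subset X) && feasible Y) #|Y|.

Definition P_level_rank (t : nat) : set vec :=
  P_level t `&`
  [set x : vec | forall X : {set Q}, \sum_(q in X) x q <= (rank X)%:R].

Definition objective (x : vec) : R := \sum_q profit q * x q.

(* The suprema are maxima: the sets involved are nonempty polytopes. *)
Definition integrality_gap (A : set vec) : R :=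
  sup [set objective x | x in A] / sup [set objective x | x in P_int].

End AnfTree.

Arguments edges {R} I.
Arguments vec {R} I.
Arguments zero_one {R} I.
Arguments K_rel {R} I S.
Arguments K_int {R} I S.
Arguments P_rel {R} I.
Arguments P_int {R} I.
Arguments P_level {R} I t.
Arguments P_level_rank {R} I t.
Arguments integrality_gap {R} I A.

Section FriggstadGao.
Variables (R : realType) (h : nat).

(* [Some w] is the vertex at distance (size w).+1 from the root [None]; it is
   reached from v_1 = Some [::] by reading w backwards, one child index per
   letter.  Thus the non-root vertices also index the requests. *)
Definition fg_nonroot : finType := (h.-1).-bseq 'I_(2 ^ h.-1).
Definition fg_vert : finType := option fg_nonroot.

Definition fg_level (v : fg_vert) : nat :=
  if v is Some w then (size w).+1 else 0.

Definition fg_parent (p v : fg_vert) : bool :=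
  match v with
  | None => false
  | Some w => match (w : seq _), p with
              | [::], None => true
              | _ :: w', Some u => w' == u
              | _, _ => false
              end
  end.

Definition fg_adj : rel fg_vert := [rel x y | fg_parent x y || fg_parent y x].

Lemma fg_parent_level p v : fg_parent p v -> fg_level v = (fg_level p).+1.
Proof.
by case: v p => [[[|a w] wh]|] // [u|] //= /eqP ->.
Qed.

Lemma fg_parent_uniq p p' v : fg_parent p v -> fg_parent p' v -> p = p'.
Proof.
case: v p p' => [[[|a w] wh]|] // [u|] // [u'|] //= /eqP wu /eqP wu'.
by congr Some; apply: val_inj; rewrite /= -wu -wu'.
Qed.

Lemma fg_adj_sym : symmetric fg_adj.
Proof. by move=> x y; rewrite /fg_adj /= orbC. Qed.

Lemma fg_adj_irr : irreflexive fg_adj.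
Proof.
move=> x; apply/negP; rewrite /fg_adj /= orbb => /fg_parent_level /eqP.
by rewrite ltn_eqF.
Qed.

Lemma fg_adj_connected x y : connect fg_adj x y.
Proof.
have toroot v : connect fg_adj v None.
  case: v => [[w wh]|]; last exact: connect0.
  elim: w wh => [|a w IHw] wh; first by apply: connect1; rewrite /fg_adj.
  have wh' : (size w <= h.-1)%N by apply: leq_trans wh; exact: leqnSn.
  apply: connect_trans (IHw wh'); apply: connect1.
  by rewrite /fg_adj /= eqxx orbT.
apply: connect_trans (toroot x) _.
by rewrite (sym_connect_sym fg_adj_sym); exact: toroot.
Qed.

Lemma fg_adj_acyclic (c : seq fg_vert) : ucycle fg_adj c -> (size c <= 2)%N.
Proof.
case: c => [|v0 c0] //; set c := v0 :: c0 => c_cyc.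
have v0c : v0 \in c by rewrite mem_head.
have [v vc vmax] := @arg_maxnP _ v0 (mem c) fg_level v0c.
have up u : u \in c -> fg_adj u v -> fg_parent u v.
  move=> uc /orP[//|/fg_parent_level uv].
  by have /= := vmax u uc; rewrite uv ltnn.
have [i s cE] := rot_to vc.
have : ucycle fg_adj (v :: s) by rewrite -cE rot_ucycle.
have -> : size c = size (v :: s) by rewrite -cE size_rot.
have sc u : u \in s -> u \in c.
  by move=> us; rewrite -(mem_rot i) cE inE us orbT.
case: s sc {cE} => [|a s] // sc; case/lastP: s sc => [|s b] // sc.
rewrite /ucycle /= rcons_path last_rcons mem_rcons !inE.
case/andP => /and3P[va _ bv] /and3P[_ + _].
have ua : fg_parent a v by apply: up; rewrite ?sc ?mem_head // fg_adj_sym.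
have ub : fg_parent b v by apply: up; rewrite // sc // inE mem_rcons mem_head orbT.
by rewrite (fg_parent_uniq ua ub) eqxx.
Qed.

(* The level of the deeper endpoint. *)
Definition fg_edge_level (e : {set fg_vert}) : nat := \max_(v in e) fg_level v.

Definition fg_cap (e : {set fg_vert}) : R :=
  2 ^+ (h * (h - fg_edge_level e).+1).

Lemma fg_cap_gt0 x y : fg_adj x y -> 0 < fg_cap [set x; y]%SET.
Proof. by move=> _; rewrite exprn_gt0. Qed.

Definition fg_src (w : fg_nonroot) : fg_vert := Some w.
Definition fg_tgt (w : fg_nonroot) : fg_vert := None.

Lemma fg_src_neq_tgt w : fg_src w != fg_tgt w.
Proof. by []. Qed.

Definition fg_dem (w : fg_nonroot) : R :=
  let l := fg_level (Some w) in 2 ^+ (h * (h - l).+1) - 2 ^+ (h * (h - l)).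

Lemma fg_dem_ge0 w : 0 <= fg_dem w.
Proof. by rewrite subr_ge0 ler_weXn2l ?ler1n // leq_mul2l leqnSn orbT. Qed.

Definition fg_profit (w : fg_nonroot) : R :=
  2 ^- (h.-1 * (fg_level (Some w)).-1).

Lemma fg_profit_ge0 w : 0 <= fg_profit w.
Proof. by rewrite invr_ge0 exprn_ge0. Qed.

Definition T_FG : anf_tree R :=
  AnfTree fg_adj_sym fg_adj_irr fg_adj_connected fg_adj_acyclic fg_cap_gt0
    fg_src_neq_tgt fg_dem_ge0 fg_profit_ge0.

End FriggstadGao.

(* Main.v *)
(* Write m = 2^(h-1), so that every level carries total profit 1, and cut the
   levels into blocks of L consecutive ones, where
   1 + m + ... + m^(L-1) <= t < m^(L+1).  The edges above the vertices of one
   block inside the subtree of v number at most t, so a point of P^t satisfies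
   every inequality valid for the 0/1 points that respect these edges.  Such a
   0/1 point earns at most twice the profit of v in the block: if it routes v,
   the capacity left below v is worth at most profit v, and otherwise one
   recurses into the children.  Hence each block contributes at most 2 on P^t,
   and t >= k^c - 1 with k >= m^(h-1) leaves at most 3/c blocks, while P_I has a
   point of profit 1. *)
Require Import Defs.
From mathcomp Require Import all_boot all_order all_algebra.
From mathcomp Require Import all_classical all_reals all_analysis.
From mathcomp Require Import ring lra zify.

Set Implicit Arguments.
Unset Strict Implicit.
Unset Printing Implicit Defensive.

Import Order.TTheory GRing.Theory Num.Theory.
Local Open Scope ring_scope.

Local Arguments profit : simpl never.
Local Arguments cap : simpl never.
Local Arguments dem : simpl never.

(** * Convex hulls, padding of edge sets, and the block length *)

Lemma conv_hull_le (R : realType) (I : anf_tree R) (A : set (vec I))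
    (f : req I -> R) (b : R) :
  (forall x, A x -> \sum_q f q * x q <= b) ->
  forall x, conv_hull A x -> \sum_q f q * x q <= b.
Proof.
(* The half-space is convex and contains [A], so it contains the smallest such set. *)
move=> Ab; apply: (@smallest_sub _ _ A
  [set x : vec I | \sum_q f q * x q <= b]%classic) => //.
move=> x y l; rewrite !inE /= => xb yb.
rewrite (eq_bigr (fun q =>
  l%:num * (f q * x q) + (1 - l%:num) * (f q * y q))); last first.
  move=> q _; rewrite !ffunE mulrDr; congr (_ + _); exact: mulrCA.
rewrite big_split /= -!mulr_sumr.
have l0 : 0 <= l%:num by [].
have l1 : l%:num <= 1 by [].
nra.
Qed.

(** [P_level t] only speaks of edge sets of size exactly [t]; this pads the edges of a block up to
    that size. *)
Lemma exists_card_between (T : finType) (A B : {set T}) n :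
  A \subset B -> (#|A| <= n <= #|B|)%N ->
  exists C : {set T}, [/\ A \subset C, C \subset B & #|C| = n].
Proof.
move=> AB /andP[An nB].
have [k kn] : exists k, n = (#|A| + k)%N by exists (n - #|A|)%N; rewrite subnKC.
elim: k n kn An nB => [|k IHk] n nE An nB.
  by exists A; rewrite nE addn0.
have [||C [sAC CB Ck]] := IHk (#|A| + k)%N erefl; rewrite ?leq_addr //.
  by apply: leq_trans nB; rewrite nE leq_add2l.
have /subsetPn[z zB zC] : ~~ (B \subset C).
  apply/negP => /subset_leq_card; rewrite Ck leqNgt => /negP; apply.
  by rewrite (leq_trans _ nB) // nE addnS.
exists (z |: C)%SET; split.
- exact: fintype.subset_trans sAC (finset.subsetUr _ _).
- by rewrite finset.subUset finset.sub1set zB.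
- by rewrite cardsU1 zC Ck nE addnS.
Qed.

Lemma sum_expn_le m n : (1 < m)%N -> (\sum_(i < n) m ^ i <= m ^ n)%N.
Proof.
move=> m1; elim: n => [|n IHn]; first by rewrite big_ord0.
rewrite big_ord_recr /= expnS (leq_trans (leq_add IHn (leqnn _))) //.
by rewrite addnn -mul2n leq_mul2r m1 orbT.
Qed.

Lemma exists_block_length m t : (1 < m)%N -> (0 < t)%N ->
  exists l, (\sum_(i < l.+1) m ^ i <= t < m ^ l.+2)%N.
Proof.
move=> m1 t0; have [tm|mt] := ltnP t m.
  exists 0; rewrite big_ord1 expn0 t0 (ltn_trans tm) //.
  by rewrite -[X in (X < _)%N]expn1 ltn_exp2l.
(* For [m <= t < m ^ l.+2] with [m ^ l.+1 <= t], the geometric sum of [l.+1] terms is at most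
   [m ^ l.+1]. *)
have := trunc_log_bounds m1 t0.
have : (0 < trunc_log m t)%N by rewrite trunc_log_gt0; lia.
case: (trunc_log m t) => // l _ /andP[lt tl].
by exists l; rewrite tl andbT (leq_trans _ lt) // sum_expn_le.
Qed.

(** * Tree structure: ancestors, edges and paths to the root *)

Section FriggstadGao.
Variables (R : realType) (h : nat).
Hypothesis h2 : (2 <= h)%N.

Notation node := (fg_nonroot h).
Notation I := (T_FG R h).

Lemma size_node (w : node) : (size w < h)%N.
Proof. by have := size_bseq w; rewrite -ltnS prednK // ltnW. Qed.

Lemma size_drop_node n (w : node) : (size (drop n w) <= h.-1)%N.
Proof. by rewrite size_drop (leq_trans (leq_subr _ _)) ?size_bseq. Qed.

(** Words are read backwards from [v_1], so dropping letters at the front climbs the tree, and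
    [suffix v w] says that [v] is [w] or an ancestor of it. *)
Definition ancestor n (w : node) : node := Bseq (size_drop_node n w).

Definition parent (w : node) : fg_vert h :=
  if nilp w then None else Some (ancestor 1 w).

Lemma fg_parentE u w : fg_parent u (Some w) = (u == parent w).
Proof.
case: w u => [[|a w] wh] [u|] //=.
rewrite /parent /= (inj_eq Some_inj) eq_sym -val_eqE /=.
by rewrite drop0.
Qed.

Lemma fg_parent_parent w : fg_parent (parent w) (Some w).
Proof. by rewrite fg_parentE. Qed.

Definition edge_above (w : node) : {set fg_vert h} :=
  [set Some w; parent w]%SET.

(** Two distinct vertices with the same edge above them would each be the parent of the other, which
    the levels forbid. *)
Lemma edge_above_inj : injective edge_above.
Proof.
move=> u w uw.
have := fg_parent_level (fg_parent_parent u).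
have := fg_parent_level (fg_parent_parent w).
have : Some u \in edge_above w by rewrite -uw !inE eqxx.
have : Some w \in edge_above u by rewrite uw !inE eqxx.
rewrite !inE => /orP[/eqP[->]//|/eqP <-] /orP[/eqP[->]//|/eqP <-] -> /eqP.
by rewrite -addn2 -{1}[fg_level _]addn0 eqn_add2l.
Qed.

Lemma edge_above_in w : edge_above w \in edges I.
Proof.
rewrite inE; apply/existsP; exists (Some w); apply/existsP; exists (parent w).
by apply/andP; split=> //; apply/orP; right; exact: fg_parent_parent.
Qed.

Lemma fg_cap_edge_above w :
  cap (edge_above w : {set vert I}) = 2 ^+ (h * (h - size w)) :> R.
Proof.
have -> : cap (edge_above w : {set vert I}) = fg_cap R (edge_above w) by [].
rewrite /fg_cap; congr (_ ^+ (h * _)).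
have -> : fg_edge_level (edge_above w) = (size w).+1.
  have lw := fg_parent_level (fg_parent_parent w).
  rewrite /fg_edge_level /edge_above big_setU1 ?big_set1 /=.
    by rewrite maxnC -[(size w).+1]/(fg_level (Some w)) lw; apply/maxn_idPr.
  rewrite inE; apply/eqP => wp; move: lw; rewrite -wp /=; lia.
exact: subnSK (size_node w).
Qed.

(* Once a simple path moves away from the root it can never turn back. *)
Lemma level_last_down (x y : fg_vert h) p :
  fg_parent x y -> path (@fg_adj h) y p -> uniq (x :: y :: p) ->
  (fg_level y <= fg_level (last y p))%N.
Proof.
elim: p x y => [|z p IHp] x y xy //= /andP[/orP[yz|zy] zp].
  move=> /and3P[_ yp up]; apply: leq_trans (IHp y z yz zp _); last by rewrite /= yp.
  by rewrite (fg_parent_level yz).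
by rewrite (fg_parent_uniq xy zy) !inE eqxx orbT.
Qed.

(** A first step to a child is impossible: by [level_last_down] the path would then end strictly
    below the root. *)
Lemma simple_path_to_root w p :
  @simple_path _ I (Some w) None p ->
  exists2 p', p = parent w :: p' & @simple_path _ I (parent w) None p'.
Proof.
case: p => [|z p] /=; first by case/and3P.
case/and3P => /= /andP[/orP[wz|zw] zp] up /eqP lp.
  have := level_last_down wz zp up; rewrite lp.
  by rewrite (fg_parent_level wz).
move: zw; rewrite fg_parentE => /eqP <-; exists p => //.
by apply/and3P; split=> //; [case/andP: up | apply/eqP].
Qed.

Definition walk_edges (x : fg_vert h) p : seq {set fg_vert h} :=
  [seq [set a.1; a.2]%SET | a <- zip (x :: p) p].

(** [the_path] is an opaque choice, so its edges are described through an arbitrary simple path to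
    the root. *)
Lemma mem_path_edges e (w : req I) :
  exists2 p, @simple_path _ I (Some w) None p &
    (e \in path_edges w) = (e \in walk_edges (Some w) p).
Proof.
exists (the_path (src w) (tgt w)); last by rewrite inE.
exact: (xchooseP (simple_path_exists (src w) (tgt w))).
Qed.

Lemma edge_above_walk (v w : node) p :
  suffix v w -> @simple_path _ I (Some w) None p ->
  edge_above v \in walk_edges (Some w) p.
Proof.
case: w => w wh.
elim: w wh p => [|a w IHw] wh p vw /simple_path_to_root[p' -> wp'].
  move: vw; rewrite suffixs0 => /eqP v0.
  rewrite /walk_edges /= inE; suff -> : v = Bseq wh by rewrite eqxx.
  exact: val_inj.
have [->|vaw] := eqVneq v (Bseq wh); first by rewrite /walk_edges /= inE eqxx.
rewrite /walk_edges /= inE; apply/orP; right.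
have wh' : (size w <= h.-1)%N by apply: ltnW.
have pE : parent (Bseq wh) = Some (Bseq wh').
  by rewrite /parent /=; congr Some; apply: val_inj; rewrite /= drop0.
rewrite pE in wp' *; apply: IHw wp'.
case/suffixP: vw => [[|b s]] /= awE.
  by case/eqP: vaw; apply: val_inj.
by case: awE => _ ->; apply/suffixP; exists s.
Qed.

Lemma req_through_edge_above (v : node) (w : req I) :
  suffix v (w : node) -> w \in @req_through _ I (edge_above v).
Proof.
move=> vw; have [p wp eE] := mem_path_edges (edge_above v) w.
by rewrite inE eE edge_above_walk.
Qed.

Lemma suffix_ancestor n w : suffix (ancestor n w) w.
Proof. exact: suffix_drop. Qed.

Lemma suffix_ancestorE (v w : node) :
  suffix v w = (ancestor (size w - size v) w == v).
Proof. by rewrite suffixE. Qed.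

Lemma fg_profitE (w : node) : @profit _ I w = 2 ^- (h.-1 * size w).
Proof. by []. Qed.

Lemma fg_demE (w : node) :
  @dem _ I w = 2 ^+ (h * (h - size w)) - 2 ^+ (h * (h - (size w).+1)).
Proof.
rewrite /dem /= /fg_dem /=; congr (2 ^+ (h * _) - _).
exact: subnSK (size_node w).
Qed.

(** * Counting nodes, and profit against demand *)

Lemma card_level s : (#|[set w : node | size w == s]| <= (2 ^ h.-1) ^ s)%N.
Proof.
apply: (@leq_trans #|{: s.-tuple 'I_(2 ^ h.-1)}|); last by rewrite card_tuple card_ord.
(* On words that are too long [insub_bseq] returns a default word; this is harmless, since [f] only
   has to cover the level. *)
pose f (u : s.-tuple 'I_(2 ^ h.-1)) : node := insub_bseq h.-1 u.
apply: leq_trans (leq_imset_card f _); apply: subset_leq_card.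
apply/fintype.subsetP => w; rewrite inE => ws; apply/imsetP; exists (Tuple ws) => //.
by rewrite /f /= [RHS]valKd.
Qed.

Lemma card_block l (v : node) :
  (#|[set w : node | suffix v w && (size w < size v + l.+1)%N]|
     <= \sum_(i < l.+1) (2 ^ h.-1) ^ i)%N.
Proof.
apply: (@leq_trans #|{: l.-bseq 'I_(2 ^ h.-1)}|); last by rewrite card_bseq card_ord.
pose f (u : l.-bseq 'I_(2 ^ h.-1)) : node := insub_bseq h.-1 (u ++ v).
apply: leq_trans (leq_imset_card f _); apply: subset_leq_card.
apply/fintype.subsetP => w; rewrite inE => /andP[/suffixP[u wE] wl].
have ul : (size u <= l)%N by move: wl; rewrite wE size_cat addnC ltn_add2l.
apply/imsetP; exists (Bseq ul) => //.
by rewrite /f /= -wE [RHS]valKd.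
Qed.

Lemma card_children (v : node) :
  (#|[set u : node | suffix v u && (size u == (size v).+1)]| <= 2 ^ h.-1)%N.
Proof.
apply: (@leq_trans #|'I_(2 ^ h.-1)|); last by rewrite card_ord.
pose f (a : 'I_(2 ^ h.-1)) : node := insub_bseq h.-1 (a :: v).
apply: leq_trans (leq_imset_card f _); apply: subset_leq_card.
apply/fintype.subsetP => w; rewrite inE => /andP[/suffixP[u wE] ws].
case: u wE ws => [|a [|b u]] wE; rewrite wE size_cat /=; try lia.
move=> _; apply/imsetP; exists a => //.
by rewrite /f -cat1s -wE [RHS]valKd.
Qed.

Lemma card_node_ge : (2 ^ (h.-1 * h.-1) <= #|req I|)%N.
Proof.
have -> : #|req I| = #|{: h.-1.-bseq 'I_(2 ^ h.-1)}| by [].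
by rewrite card_bseq big_ord_recr /= card_ord expnM leq_addl.
Qed.

(* Below a request v, profit per demand is so small that filling the capacity
   left over by v is worth no more than v itself. *)
Lemma profit_le_dem (v w : node) : suffix v w -> v != w ->
  @profit _ I w * 2 ^+ (h * (h - (size v).+1)) <= @dem _ I w * @profit _ I v.
Proof.
move=> /suffixP[u wE] vw; rewrite !fg_profitE fg_demE.
have wh := size_node w.
have u0 : (0 < size u)%N.
  by case: u wE => // wE; case/eqP: vw; apply: val_inj.
have sw : size w = (size u + size v)%N by rewrite wE size_cat.
set e := (h - (size w).+1)%N.
have -> : (h - size w = e.+1)%N by rewrite /e; lia.
have -> : (h - (size v).+1 = e + size u)%N by rewrite /e; lia.
rewrite ler_pdivrMl ?exprn_gt0 //.
rewrite mulrA ler_pdivlMr ?exprn_gt0 // sw.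
rewrite !mulnDr mulnS !exprD.
have -> : 2 ^+ (h * size u) = 2 ^+ size u * 2 ^+ (h.-1 * size u) :> R.
  by rewrite -exprD -mulSn prednK // ltnW.
(* With denominators cleared and common powers factored out, this is all that remains; it holds
   because [size u <= h.-1]. *)
have le2 : 2 ^+ size u <= 2 ^+ h - 1 :> R.
  have -> : 2 ^+ h = 2 * 2 ^+ h.-1 :> R by rewrite -exprS prednK // ltnW.
  have : 2 ^+ size u <= 2 ^+ h.-1 :> R by rewrite ler_weXn2l ?ler1n //; lia.
  have : 1 <= 2 ^+ h.-1 :> R by rewrite exprn_ege1 ?ler1n.
  lra.
set a := 2 ^+ (h.-1 * size u).
set b := 2 ^+ (h.-1 * size v).
set c := 2 ^+ (h * e).
set d := 2 ^+ size u in le2 *; set g := 2 ^+ h in le2 *.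
have cab : 0 <= c * a * b by rewrite !mulr_ge0 ?exprn_ge0.
rewrite (_ : c * _ * b = c * a * b * d); last by ring.
rewrite (_ : _ * _ * (_ - _) = c * a * b * (g - 1)); last by ring.
by rewrite ler_wpM2l.
Qed.

(** * Profit of a single block *)

Definition block_edges (v : node) L : {set {set vert I}} :=
  [set edge_above w | w : node & suffix v w && (size w < size v + L)%N]%SET.

Lemma edge_constraint (S : {set {set vert I}}) x (v : node) (P : pred node) :
  K_rel I S x -> edge_above v \in S -> (forall w, P w -> suffix v w) ->
  \sum_(w | P w) @dem _ I w * x w <= 2 ^+ (h * (h - size v)).
Proof.
move=> [x01 xS] vS Pv; rewrite -fg_cap_edge_above; apply: le_trans (xS _ vS).
rewrite [leLHS]big_mkcond [leRHS]big_mkcond; apply: ler_sum => w _ /=.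
have /andP[x0 _] := x01 w.
case: ifP => [/Pv/req_through_edge_above -> //|_].
by case: ifP => // _; rewrite mulr_ge0 // (@dem_ge0 _ I).
Qed.

(** Induction on [n], which bounds the number of levels from [v] to the cutoff. The cutoff [b] is an
    absolute depth, so it stays the same when passing to the children. *)
Lemma block_profit_01 S x b n (v : node) :
  K_rel I S x -> zero_one I x -> (b <= size v + n)%N ->
  (forall w : node, suffix v w -> (size w < b)%N -> edge_above w \in S) ->
  \sum_(w : node | suffix v w && (size w < b)%N) @profit _ I w * x w
    <= 2 * @profit _ I v.
Proof.
move=> xS x01; elim: n v => [|n IHn] v bn vS.
  rewrite big1 ?mulr_ge0 ?profit_ge0 // => w /andP[/size_suffix vw wb].
  by have := leq_trans wb bn; rewrite addn0 ltnNge vw.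
have [bv|vb] := leqP b (size v).
  by apply: IHn => //; rewrite (leq_trans bv) // leq_addr.
rewrite (bigD1 v) /=; last by rewrite suffix_refl.
have [xv0|xv1] := x01 v; last first.
  rewrite xv1 mulr1 mulr_natl mulr2n lerD2l.
  (* [c] is the capacity left on the edge above [v] once [v] is routed. After scaling by [c],
     [profit_le_dem] turns profits into demands. *)
  set c := 2 ^+ (h * (h - (size v).+1)) : R.
  have c0 : 0 < c by rewrite exprn_gt0.
  rewrite -(ler_pM2r c0) mulr_suml.
  apply: (@le_trans _ _ (\sum_(w : node | suffix v w && (size w < b)%N && (w != v))
      @dem _ I w * x w * @profit _ I v)).
    apply: ler_sum => w /andP[/andP[vw _] wv].
    have /andP[x0 _] := xS.1 w.
    rewrite mulrAC (mulrAC (dem _)) ler_wpM2r // profit_le_dem // eq_sym //.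
  rewrite -mulr_suml mulrC ler_wpM2l ?profit_ge0 //.
  have := @edge_constraint S x v (fun w => suffix v w && (size w < b)%N) xS.
  rewrite (bigD1 v) /=; last by rewrite suffix_refl.
  rewrite xv1 mulr1 fg_demE => /(_ (vS v (suffix_refl _) vb)) ec.
  have : forall w : node, suffix v w && (size w < b)%N -> suffix v w.
    by move=> w /andP[].
  by move=> /ec; rewrite -/c; lra.
rewrite xv0 mulr0 add0r.
(* The child of [v] whose subtree contains [w]. *)
pose child (w : node) := ancestor (size w - (size v).+1) w.
have strict (w : node) : suffix v w -> w != v -> (size v < size w)%N.
  move=> vw wv; rewrite ltn_neqAle size_suffix // andbT.
  apply: contraNneq wv => vwE; move: vw; rewrite suffixE vwE subnn drop0.
  by move=> wv; apply/eqP/val_inj/eqP.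
rewrite (partition_big child
  (fun u : node => suffix v u && (size u == (size v).+1))) /=; last first.
  move=> w /andP[/andP[vw _] wv]; have lt := strict w vw wv.
  rewrite suffixE /= size_drop subKn // subSnn drop_drop add1n subnSK //.
  by rewrite -suffixE vw eqxx.
apply: (@le_trans _ _ (\sum_(u : node | suffix v u && (size u == (size v).+1))
    2 * @profit _ I u)).
  apply: ler_sum => u /andP[vu /eqP us].
  apply: le_trans (IHn u _ _); first last.
  - by move=> w uw; apply: vS; apply: suffix_trans uw.
  - by rewrite us addSnnS.
  rewrite le_eqVlt; apply/orP; left; apply/eqP; apply: eq_bigl => w.
  rewrite (suffix_ancestorE u) us -/(child w).
  case: (eqVneq (child w) u) => [cw|_]; last by rewrite andbF.
  have uw : suffix u w by rewrite -cw suffix_ancestor.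
  rewrite (suffix_trans vu uw) andbT /=; case: (size w < b)%N => //=.
  by apply: contraTneq uw => ->; apply/negP => /size_suffix; rewrite us ltnn.
(* There are at most [2 ^ h.-1] children, each with profit [2 ^- h.-1] times that of [v], so
   together they earn no more than [v]. *)
rewrite (eq_bigr (fun=> 2 * 2 ^- (h.-1 * (size v).+1))); last first.
  by move=> u /andP[_ /eqP us]; rewrite fg_profitE us.
rewrite sumr_const -mulrnAr ler_wpM2l // fg_profitE mulnS exprD invfM.
rewrite -mulrnAl ler_piMl ?invr_ge0 ?exprn_ge0 //.
rewrite -[X in X <= _]mulr_natl ler_pdivrMr ?exprn_gt0 // mul1r -natrX ler_nat.
by apply: leq_trans (card_children v); rewrite cardsE.
Qed.

Lemma profit_level_sum_le1 s : \sum_(v : node | size v == s) @profit _ I v <= 1.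
Proof.
rewrite (eq_bigr (fun=> 2 ^- (h.-1 * s))); last first.
  by move=> v /eqP vs; rewrite fg_profitE vs.
rewrite sumr_const -[leLHS]mulr_natl ler_pdivrMr ?exprn_gt0 // mul1r.
rewrite -natrX ler_nat expnM.
by apply: leq_trans (card_level s); rewrite cardsE.
Qed.

Lemma card_edges_ge : (#|req I| <= #|edges I|)%N.
Proof.
rewrite -(card_imset predT edge_above_inj); apply: subset_leq_card.
by apply/fintype.subsetP => _ /imsetP[w _ ->]; exact: edge_above_in.
Qed.

Lemma block_profit_le t l x (v : node) :
  P_level I t x -> (\sum_(i < l.+1) (2 ^ h.-1) ^ i <= t <= #|req I|)%N ->
  \sum_(w : node | suffix v w && (size w < size v + l.+1)%N) @profit _ I w * x w
    <= 2 * @profit _ I v.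
Proof.
move=> tx /andP[lt tk].
have [||S [vS SE St]] := @exists_card_between _ (block_edges v l.+1) (edges I) t.
- by apply/fintype.subsetP => _ /imsetP[w _ ->]; exact: edge_above_in.
- rewrite (leq_trans tk card_edges_ge) andbT (leq_trans (leq_imset_card _ _)) //.
  by apply: leq_trans (card_block l v) lt.
rewrite big_mkcond /=.
(* Extending the profits by zero outside the block gives a linear functional on all requests, as
   [conv_hull_le] expects. *)
pose f (w : req I) :=
  if suffix v w && (size w < size v + l.+1)%N then profit w else 0.
rewrite (eq_bigr (fun w => f w * x w)); last first.
  by move=> w _; rewrite /f; case: ifP; rewrite ?mul0r.
apply: conv_hull_le (tx S (conj SE St)) => y [yS y01].
rewrite (eq_bigr (fun w : node => if suffix v w && (size w < size v + l.+1)%N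
  then @profit _ I w * y w else 0)); last first.
  by move=> w _; rewrite /f; case: ifP; rewrite ?mul0r.
rewrite -big_mkcond /=; apply: block_profit_01 yS y01 (leqnn _) _ => w vw wl.
by apply: (fintype.subsetP vS); apply: imset_f; rewrite inE vw wl.
Qed.

(** * Summing over all blocks *)

Lemma objective_P_level_le t l x :
  P_level I t x -> (\sum_(i < l.+1) (2 ^ h.-1) ^ i <= t <= #|req I|)%N ->
  objective x <= 2 * (h.-1 %/ l.+1).+1%:R.
Proof.
move=> tx lt; rewrite /objective.
(* The top of the block of [w]: its ancestor at the largest depth that is a multiple of [l.+1]. *)
pose top (w : node) := ancestor (size w %% l.+1) w.
have size_top w : size (top w) = (size w %/ l.+1 * l.+1)%N.
  by rewrite /= size_drop {1}(divn_eq (size w) l.+1) addnK.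
rewrite (partition_big top (fun v : node => l.+1 %| size v)%N) /=; last first.
  by move=> w _; rewrite size_top dvdn_mull.
apply: (@le_trans _ _ (\sum_(v : node | (l.+1 %| size v)%N) 2 * @profit _ I v)).
  apply: ler_sum => v lv.
  apply: le_trans (block_profit_le v tx lt); rewrite le_eqVlt; apply/orP; left.
  apply/eqP/eq_bigl => w; apply/eqP/idP => [<-|/andP[/suffixP[s wE] wl]].
    rewrite suffix_ancestor size_top /= {1}(divn_eq (size w) l.+1).
    by rewrite ltn_add2l ltn_mod.
  apply: val_inj => /=; rewrite {2}wE.
  have -> : (size w %% l.+1 = size s)%N; last by rewrite drop_size_cat.
  move: wl; rewrite wE size_cat addnC ltn_add2l => sl.
  by move/dvdnP: lv => [q ->]; rewrite modnMDl modn_small.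
rewrite -mulr_sumr ler_wpM2l //.
(* Tops are grouped by depth. Depths run from 0 to [h.-1], hence this number of groups, and each
   group lies in one level, of total profit at most 1. *)
pose blk (v : node) : 'I_(h.-1 %/ l.+1).+1 := inord (size v %/ l.+1).
rewrite (partition_big blk predT) //=.
rewrite -[leRHS](mulr1 _) mulr_natl -[X in _ *+ X]card_ord -sumr_const.
apply: ler_sum => i _; apply: le_trans (profit_level_sum_le1 (i * l.+1)%N).
rewrite [leLHS]big_mkcond [leRHS]big_mkcond; apply: ler_sum => v _ /=.
case: ifP => [/andP[lv /eqP vi]|_]; last by case: ifP => // _; exact: profit_ge0.
rewrite -vi inordK; first by rewrite divnK // eqxx.
by rewrite ltnS leq_div2r // size_bseq.
Qed.

(** * Lower bound on the integral optimum *)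

Lemma objective_P_int_le x : P_int I x -> objective x <= \sum_q @profit _ I q.
Proof.
apply: conv_hull_le => y [[y01 _] _]; apply: ler_sum => q _.
by rewrite ler_piMr ?profit_ge0 //; have /andP[] := y01 q.
Qed.

(** The edge above [v_1] already reaches the root, and a simple path ending there cannot continue
    and return. *)
Lemma path_edges_root e : e \in @path_edges _ I ([bseq] : node) ->
  e = edge_above ([bseq] : node).
Proof.
have [p rp ->] := mem_path_edges e ([bseq] : node).
have [p' -> {rp}] := simple_path_to_root rp.
case: p' => [|z p'] /and3P[_ /= up /eqP lp]; first by rewrite inE => /eqP.
have pr : parent ([bseq] : node) = None by [].
by move: up; rewrite pr -{1}lp mem_last.
Qed.

Lemma sup_P_int_ge1 : 1 <= sup [set objective x | x in P_int I]%classic.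
Proof.
(* Route only the request of [v_1]: its profit is 1 and its demand is below the capacity of its
   single edge. *)
pose x0 : vec I := [ffun q => ((q : node) == [bseq])%:R].
have x0E : objective x0 = 1.
  rewrite /objective (bigD1 ([bseq] : node)) //= big1 ?addr0.
    by rewrite ffunE eqxx mulr1 fg_profitE muln0 expr0 invr1.
  by move=> q /negPf qr; rewrite ffunE qr mulr0.
apply: ub_le_sup.
  (* The crude total-profit bound ensures that the supremum is taken over a bounded set. *)
  by exists (\sum_q @profit _ I q) => _ [x /objective_P_int_le xle <-].
exists x0 => //; apply: sub_gen_smallest; split; last first.
  by move=> q; rewrite ffunE; case: (_ == _); [right|left].
split=> [q|e eE]; first by rewrite ffunE; case: (_ == _); rewrite ?lexx ?ler01.
rewrite big_mkcond (bigD1 ([bseq] : node)) //= big1 ?addr0; last first.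
  by move=> q /negPf qr; rewrite ffunE qr mulr0; case: ifP.
case: ifP => [|_]; last first.
  move: eE; rewrite inE => /existsP[y /existsP[z /andP[yz /eqP ->]]].
  exact: ltW (cap_gt0 yz).
rewrite inE => /path_edges_root ->.
rewrite fg_cap_edge_above fg_demE ffunE eqxx mulr1.
by rewrite gerBl exprn_ge0.
Qed.

End FriggstadGao.

(** * Choice of the block length and the final constant *)

Theorem theorem5 (R : realType) :
  exists2 C : R, 0 < C &
    forall (h : nat) (c : R), (2 <= h)%N -> 0 < c <= 1 ->
      let I := T_FG R h in
      let t := Num.truncn (#|req I|%:R `^ c) in
      integrality_gap I (P_level I t) <= C / c /\
      integrality_gap I (P_level_rank I t) <= C / c.
Proof.
exists 6 => // h c h2 /andP[c0 c1] I t.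
have m1 : (1 < 2 ^ h.-1)%N.
  by rewrite -[X in (X < _)%N](expn0 2) ltn_exp2l //; lia.
have k1 : 1 <= #|req I|%:R :> R.
  by rewrite ler1n (leq_trans _ (card_node_ge R h)) // expn_gt0.
have tk : (t <= #|req I|)%N.
  rewrite -(ler_nat R); apply: le_trans (ler1_powR k1 c1).
  by rewrite truncn_le powR_ge0.
have t0 : (0 < t)%N.
  rewrite truncn_ge_nat ?powR_ge0 //.
  by have := ler_powR k1 (ltW c0); rewrite powRr0.
have [l /andP[lt tl]] := exists_block_length m1 t0.
(* Otherwise [k ^ c] would be at least [m ^ l.+2], hence at least [t + 1], using [k >= m ^ h.-1]
   with [m = 2 ^ h.-1]; this contradicts the truncation defining [t]. *)
have cl : h.-1%:R * c < l.+2%:R.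
  rewrite ltNge; apply/negP => lc.
  have : #|req I|%:R `^ c < t.+1%:R.
    by have /andP[] := truncn_itv (powR_ge0 #|req I|%:R c).
  apply/negP; rewrite -leNgt.
  apply: (@le_trans _ _ (((2 ^ h.-1) ^ l.+2)%N%:R)); first by rewrite ler_nat.
  rewrite -expnM natrX -powR_mulrn // natrM.
  apply: (@le_trans _ _ (2 `^ (h.-1%:R * (h.-1%:R * c)))).
    by rewrite ler_powR ?ler1n // ler_wpM2l.
  rewrite mulrA powRrM -natrM powR_mulrn // -natrX.
  by rewrite ge0_ler_powR ?nnegrE ?ler0n ?(ltW c0) // ler_nat card_node_ge.
have bound (A : set (vec I)) : (A `<=` P_level I t)%classic ->
    integrality_gap I A <= 6 / c.
  move=> At.
  have gap : 2 * (h.-1 %/ l.+1).+1%:R <= 6 / c :> R.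
    have : (h.-1 %/ l.+1)%:R * l.+1%:R <= h.-1%:R :> R.
      by rewrite -natrM ler_nat leq_divM.
    have l1 : 1 <= l.+1%:R :> R by rewrite ler1n.
    move: cl; rewrite -[l.+2]addn1 -[(_ %/ _).+1]addn1 !natrD ler_pdivlMr //.
    set d := (_ %/ _)%:R; set L := l.+1%:R in l1 *; set N := h.-1%:R => Nc dN.
    (* Here [d * L <= N] and [N * c < L + 1 <= 2 * L]. With [c <= 1] this gives [(d + 1) * c < 3],
       and the factor 2 per block yields the constant 6. *)
    have dc : d * c < 2.
      have L0 : 0 < L by lra.
      rewrite -(ltr_pM2r L0); nra.
    lra.
  have sup_le : sup [set objective x | x in A]%classic <= 6 / c.
    (* For an empty [A] the supremum is 0 by convention. *)
    have [->|/set0P A0] := eqVneq A set0.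
      by rewrite image_set0 sup0 divr_ge0 // ltW.
    apply: ge_sup; first by case: A0 => x Ax; exists (objective x), x.
    move=> _ [x Ax <-]; apply: le_trans gap.
    by apply: objective_P_level_le (At x Ax) _ => //; rewrite lt.
  have den := sup_P_int_ge1 R h2.
  rewrite /integrality_gap ler_pdivrMr ?(lt_le_trans ltr01) //.
  by rewrite (le_trans sup_le) // ler_peMr // divr_ge0 // ltW.
by split; apply: bound => // x [].
Qed.
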